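(* Let $\Sigma$ be a finite set of clauses on a finite set $V$ of variables, and let $k$ be an integer with $k \geq w(\Sigma)$, where $w(\Sigma)$ is the maximum width of a clause in $\Sigma$. Then the following are equivalent: (1) there is no regular resolution refutation of $\Sigma$ of width at most $k$; (2) there is a regular extendible $(k+1)$-family for $\Sigma$; (3) the Adversary wins (has a winning strategy in) the regular $(k+1)$-width game based on $\Sigma$.
   Context: Resolution. A literal is a propositional variable $x$ or its negation $\neg x$. A clause is a finite set of literals, interpreted as their disjunction; its width is the number of literals in it. The resolution rule derives $C \vee D$ from $C \vee x$ and $D \vee \neg x$. A resolution derivation of $C$ from $\Sigma$ is a sequence of clauses ending in $C$, each of which is in $\Sigma$ or derived from earlier clauses by resolution; it is a refutation of $\Sigma$ if $C$ is the empty clause. The width of a proof is the maximum width of a clause in it. An irregularity in a proof is a sequence of clauses $C_1, \dots, C_m$ of the proof ($m \geq 3$) such that each $C_{i+1}$ is derived from $C_i$ (that is, $C_i$ is one of the premisses of a resolution inference with conclusion $C_{i+1}$), and there is a variable that occurs in $C_1$ and $C_m$, but not in any $C_j$ with $1<j<m$. A proof is regular if it contains no irregularity. Extended assignments. An extended assignment to $V$ gives each variable in $V$ one of four states: positive ($1$), negative ($0$), unassigned ($\ast$), or forgotten ($\boxtimes$). In the empty extended assignment all variables are unassigned ($\ast$). The variables with value $0$ or $1$ in $\alpha$ are the live variables of $\alpha$, and $|\alpha|$ is the number of live variables. An extended assignment falsifies a clause if it gives every literal of the clause the value $0$ (so all variables of the clause are live). Write $\alpha \subseteq \beta$ if $\beta$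 results from $\alpha$ by replacing some unassigned variables by live variables (i.e. changing some values $\ast$ to $0$ or $1$). Write $\alpha \sqsubseteq \beta$ if $\alpha$ results from $\beta$ by forgetting some variables, i.e. changing the value of some live variables to $\boxtimes$. Regular extendible families. For an integer $j \ge 0$, a family $\mathcal A$ of extended assignments to $V$ is a regular extendible $j$-family for $\Sigma$ if: (i) the empty extended assignment belongs to $\mathcal A$; (ii) no assignment in $\mathcal A$ falsifies a clause in $\Sigma$; (iii) each $\alpha \in \mathcal A$ satisfies $|\alpha| \leq j$; (iv) if $\alpha \in \mathcal A$ and $\beta \sqsubseteq \alpha$ then $\beta \in \mathcal A$; (v) if $\alpha \in \mathcal A$, $|\alpha| < j$, $x \in V$ and $\alpha(x) = \ast$, then there is $\beta \in \mathcal A$ with $\alpha \subseteq \beta$ and $\beta(x) = 0$ or $\beta(x) = 1$. The regular $j$-width game based on $\Sigma$ (for an integer $j \geq 0$). Two players, the Prover and the Adversary, construct a succession of extended assignments to $V$; initially the current assignment is the empty extended assignment. In each round, the Prover first queries an unassigned ($\ast$) variable, and the Adversary assigns it a value $0$ or $1$; next, the Prover is allowed to forget some of the live variables in the resulting assignment (change their values from $0$ or $1$ to $\boxtimes$); the result, after this forgetting, is the new current assignment. (Thus the Prover can never query a previously queried variable.) The Adversary can win in two ways: first, if the current assignment (after forgetting) assigns values $0$ or $1$ to more than $j$ variables; second, if the Prover has not won up to this point, but there are no unqueried variables, so the Prover has no legal move. The Prover wins if the current assignment falsifies a clause in $\Sigma$ (if this clause contains more than $j$ variables, this counts as a win for the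 Adversary).
   Formalization: In the regular game the limit j is applied right after the Adversary's answer, before the Prover forgets; and in clause (v) of a regular extendible family, β extends α by a value for x only. With the definitions read literally the equivalence fails. *)

(* Defs.v *)
From HB Require Import structures.
From mathcomp Require Import all_boot.
Set Implicit Arguments.
Unset Strict Implicit.
Unset Printing Implicit Defensive.

(** * Resolution *)

(* [(x, true)] is the variable x, [(x, false)] its negation. *)
Definition literal (V : finType) : finType := (V * bool)%type.
Definition clause (V : finType) : finType := {set literal V}.

Definition cvars (V : finType) (C : clause V) : {set V} :=
  [set l.1 | l in C].

Definition cnf_width (V : finType) (Sigma : {set clause V}) : nat :=
  \max_(C in Sigma) #|C|.

Definition resolvent (V : finType) (P N R : clause V) : Prop :=
  exists (C D : clause V) (x : V),
    [/\ P = (x, true) |: C, N = (x, false) |: D & R = C :|: D].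

(* A derivation is a sequence of lines.  Each line carries its clause and the
   inference by which it was obtained: [None] for a member of Sigma,
   [Some (p, q)] for the resolution inference from lines p and q.  "Derived
   from" refers to these inferences, and the same clause may occur on several
   lines. *)
Definition line (V : finType) : Type := (clause V * option (nat * nat))%type.

Section Derivation.
Variables (V : finType) (Sigma : {set clause V}) (Pi : seq (line V)).

Definition line_at (i : nat) : line V := nth (set0, None) Pi i.
Definition clause_at (i : nat) : clause V := (line_at i).1.

Definition derivation : Prop :=
  forall i, i < size Pi ->
    match (line_at i).2 with
    | None => clause_at i \in Sigma
    | Some (p, q) =>
        [/\ p < i, q < i & resolvent (clause_at p) (clause_at q) (clause_at i)]
    end.

Definition refutation : Prop :=
  [/\ 0 < size Pi, derivation & clause_at (size Pi).-1 = set0].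

Definition proof_width : nat := \max_(L <- Pi) #|L.1|.

Definition premise_of : rel nat := fun i j =>
  if (line_at j).2 is Some (p, q) then (i == p) || (i == q) else false.

(* The lines i, mid, j (at least three of them) are C_1, ..., C_m. *)
Definition irregularity (i : nat) (mid : seq nat) (j : nat) : Prop :=
  [/\ mid != [::],
      path premise_of i (rcons mid j) &
      exists x : V,
        [/\ x \in cvars (clause_at i),
            x \in cvars (clause_at j) &
            all (fun h => x \notin cvars (clause_at h)) mid]].

Definition regular : Prop :=
  forall i mid j, ~ irregularity i mid j.

End Derivation.

(** * Extended assignments *)

Inductive state : Type := Live of bool | Unassigned | Forgotten.

Definition state_code (s : state) : option (option bool) :=
  match s with
  | Live b => Some (Some b) | Unassigned => Some None | Forgotten => None
  end.
Definition state_decode (c : option (option bool)) : state :=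
  match c with
  | Some (Some b) => Live b | Some None => Unassigned | None => Forgotten
  end.
Lemma state_codeK : cancel state_code state_decode.
Proof. by case. Qed.
HB.instance Definition _ := Equality.copy state (can_type state_codeK).
HB.instance Definition _ := Choice.copy state (can_type state_codeK).
HB.instance Definition _ := Countable.copy state (can_type state_codeK).
HB.instance Definition _ := Finite.copy state (can_type state_codeK).

Definition is_live (s : state) : bool := if s is Live _ then true else false.

Definition eassign (V : finType) : finType := {ffun V -> state}.

Definition empty_eassign (V : finType) : eassign V := [ffun => Unassigned].

Section ExtendedAssignments.
Variable V : finType.
Implicit Types (alpha beta : eassign V) (C : clause V).

Definition live_vars alpha : {set V} := [set x | is_live (alpha x)].

Definition falsifies alpha C : bool :=
  [forall l in C, alpha l.1 == Live (~~ l.2)].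

Definition extends alpha beta : bool :=
  [forall x, (beta x == alpha x)
             || (alpha x == Unassigned) && is_live (beta x)].

Definition forgets beta alpha : bool :=
  [forall x, (beta x == alpha x)
             || is_live (alpha x) && (beta x == Forgotten)].

Definition assign alpha (x : V) (b : bool) : eassign V :=
  [ffun y => if y == x then Live b else alpha y].

End ExtendedAssignments.

(** * Regular extendible families *)

(* In the extension clause beta gives a value to the queried variable x and
   to nothing else.  If beta could also assign further variables, these could
   only be dropped by forgetting them, and would then be lost to all later
   queries; the existence of a family would no longer exclude regular
   refutations of width below j. *)
Definition regular_extendible_family (V : finType) (Sigma : {set clause V})
    (j : nat) (A : {set eassign V}) : Prop :=
  [/\ empty_eassign V \in A,
      forall alpha, alpha \in A -> forall C, C \in Sigma -> ~~ falsifies alpha C,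
      forall alpha, alpha \in A -> #|live_vars alpha| <= j,
      forall alpha beta, alpha \in A -> forgets beta alpha -> beta \in A &
      forall alpha x, alpha \in A -> #|live_vars alpha| < j ->
        alpha x = Unassigned ->
        exists beta, [/\ beta \in A, extends alpha beta, is_live (beta x) &
                         forall y, y != x -> beta y = alpha y]].

(** * The regular width game *)

Section Game.
Variables (V : finType) (Sigma : {set clause V}) (j : nat).

(* A clause with more than j variables does not count for the Prover. *)
Definition prover_won (alpha : eassign V) : bool :=
  [exists C in Sigma, falsifies alpha C && (#|cvars C| <= j)].

(* The Adversary's answer to a query, given the succession of assignments
   constructed so far (latest first). *)
Definition adversary_strategy : Type := seq (eassign V) -> V -> bool.

(* Every play that continues from [alpha], with earlier assignments [h], and
   in which the Adversary answers according to [s], is won by the Adversary.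
   The limit j applies to the assignment that results from the Adversary's
   answer, before the Prover forgets: a query that makes more than j variables
   live loses the game for the Prover.  Hence the Prover can only query
   while fewer than j variables are live, as in the extension clause of a
   regular extendible j-family.  If the limit were checked only after
   forgetting, the Prover would win the j-game from every regular refutation
   of width j, not just from those of width below j. *)
Inductive adversary_wins_from (s : adversary_strategy) :
    seq (eassign V) -> eassign V -> Prop :=
| no_move h alpha :
    ~~ prover_won alpha ->
    (forall x, alpha x <> Unassigned) ->
    adversary_wins_from s h alpha
| next_round h alpha :
    ~~ prover_won alpha ->
    (forall x beta, alpha x = Unassigned ->
       let gamma := assign alpha x (s (alpha :: h) x) in
       #|live_vars gamma| <= j ->
       forgets beta gamma ->
       adversary_wins_from s (alpha :: h) beta) ->
    adversary_wins_from s h alpha.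

Definition adversary_wins : Prop :=
  exists s : adversary_strategy, adversary_wins_from s [::] (empty_eassign V).

End Game.

(* Main.v *)
Require Import Defs.
From mathcomp Require Import all_boot.
From Stdlib Require Import Classical.

(** A width-k regular refutation, read from the empty clause upwards, is a
    strategy for the Prover: query the variable resolved upon, move to the
    falsified premise and forget all variables outside it; regularity says that
    a forgotten variable is never queried again.  An extendible family is a set
    of positions in which the Adversary can remain.  If there is no refutation,
    a family consists of the assignments alpha that falsify no clause C having
    a width-k regular derivation all of whose variables occur in C or are
    unassigned in alpha.  If neither answer to a query x stays in the family,
    the two offending derivations can be resolved on x, and the result is
    regular: a variable of the new clause is live in alpha, so it occurs in
    either derivation only if it survives to the end of it. *)

Set Implicit Arguments.
Unset Strict Implicit.
Unset Printing Implicit Defensive.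

(** * Falsification under queries and forgetting *)

Section Assignments.
Variable V : finType.
Implicit Types (alpha beta : eassign V) (C : clause V) (U : {set V}).

Definition unassigned alpha : {set V} := [set x | alpha x == Unassigned].

Lemma cvarsP C (x : V) :
  reflect (exists b, (x, b) \in C) (x \in cvars C).
Proof.
apply: (iffP imsetP) => [[[y b] yC /= ->]|[b xC]]; first by exists b.
by exists (x, b).
Qed.

Lemma falsifiesP alpha C :
  reflect (forall x b, (x, b) \in C -> alpha x = Live (~~ b))
          (falsifies alpha C).
Proof.
apply: (iffP forall_inP) => [H x b xC|H [x b] xC]; first exact/eqP/(H _ xC).
by rewrite (H x b).
Qed.

Lemma falsifies_live alpha C :
  falsifies alpha C -> cvars C \subset live_vars alpha.
Proof.
move=> /falsifiesP F; apply/subsetP => x /cvarsP [b xC].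
by rewrite inE (F _ _ xC).
Qed.

(** No variable occurs with both signs in a falsified clause, so the literals are as many as the
    variables, all of them live. *)
Lemma card_falsified alpha C :
  falsifies alpha C -> #|C| <= #|live_vars alpha|.
Proof.
move=> F; apply: leq_trans (subset_leq_card (falsifies_live F)).
move/falsifiesP: F => F; rewrite card_in_imset // => -[x b] [y c] xC yC /= e.
move: (F _ _ xC) (F _ _ yC); rewrite /= e => -> [].
by move/(congr1 negb); rewrite !negbK => ->.
Qed.

Lemma disjoint_live_unassigned alpha C :
  falsifies alpha C -> [disjoint cvars C & unassigned alpha].
Proof.
move=> F; rewrite disjoint_subset; apply/subsetP => x.
by move=> /(subsetP (falsifies_live F)); rewrite !inE; case: (alpha x).
Qed.

Lemma live_vars_empty : live_vars (empty_eassign V) = set0.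
Proof. by apply/setP => x; rewrite !inE ffunE. Qed.

Lemma live_vars_assign alpha (x : V) (b : bool) :
  live_vars (assign alpha x b) = x |: live_vars alpha.
Proof. by apply/setP => y; rewrite !inE ffunE; case: eqP. Qed.

Lemma unassigned_assign alpha (x : V) (b : bool) :
  unassigned (assign alpha x b) = unassigned alpha :\ x.
Proof. by apply/setP => y; rewrite !inE ffunE; case: (y =P x). Qed.

Lemma forgets_unassigned beta alpha :
  forgets beta alpha -> unassigned beta = unassigned alpha.
Proof.
move=> /forallP H; apply/setP => y; rewrite !inE.
by case/orP: (H y) => [/eqP ->|/andP []] //; case: (alpha y) => // b _ /eqP ->.
Qed.

Lemma forgets_live beta alpha :
  forgets beta alpha -> live_vars beta \subset live_vars alpha.
Proof.
move=> /forallP H; apply/subsetP => y; rewrite !inE.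
by case/orP: (H y) => [/eqP ->|/andP []].
Qed.

Lemma forgets_falsifies beta alpha C :
  forgets beta alpha -> falsifies beta C -> falsifies alpha C.
Proof.
move=> /forallP H /falsifiesP F; apply/falsifiesP => x b xC.
by move: (H x); rewrite (F _ _ xC) andbF orbF => /eqP ->.
Qed.

Lemma falsifies_assign alpha (x : V) (b : bool) C :
  falsifies (assign alpha x b) C -> ~~ falsifies alpha C -> (x, ~~ b) \in C.
Proof.
move=> /falsifiesP F; apply: contraR => xC; apply/falsifiesP => y c yC.
move: (F _ _ yC); rewrite ffunE; case: eqP => // yx [e].
by case/negP: xC; rewrite e negbK -yx.
Qed.

End Assignments.

(** * Joining regular derivations by a resolution step *)

Section RegularDerivations.
Variables (V : finType) (Sigma : {set clause V}) (k : nat).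
Implicit Types (U : {set V}) (C P N : clause V) (Pi : seq (line V)).

Definition shift_line d (L : line V) : line V :=
  (L.1, omap (fun pq => (d + pq.1, d + pq.2)) L.2).

Definition embedded d Pi Pi' : Prop :=
  forall i, i < size Pi -> line_at Pi' (d + i) = shift_line d (line_at Pi i).

Lemma embedded_clause_at d Pi Pi' i :
  embedded d Pi Pi' -> i < size Pi ->
  clause_at Pi' (d + i) = clause_at Pi i.
Proof. by move=> E li; rewrite /clause_at E. Qed.

(** By [derivation], premises point backwards within [Pi], so a path that ends in the shifted copy
    lies entirely inside it. *)
Lemma embedded_path d Pi Pi' i s j :
  embedded d Pi Pi' -> derivation Sigma Pi -> j < size Pi ->
  path (premise_of Pi') i (rcons s (d + j)) ->
  exists i' s', [/\ i = d + i', s = map (addn d) s', i' < size Pi,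
    all (fun h => h < size Pi) s' & path (premise_of Pi) i' (rcons s' j)].
Proof.
move=> E D.
have step a b : b < size Pi -> premise_of Pi' a (d + b) ->
    exists2 a', a = d + a' /\ a' < size Pi & premise_of Pi a' b.
  move=> lb; rewrite /premise_of E //=.
  move: (D b lb); case: (line_at Pi b).2 => //= -[p q] [pb qb _].
  case/orP => /eqP ->; [exists p | exists q]; rewrite ?eqxx ?orbT //;
  by split=> //; apply: ltn_trans lb.
move=> lj; elim: s i => [|b s IH] i /=.
  by rewrite andbT => /(step _ _ lj) [i' [-> li] pi]; exists i', [::]; rewrite /= pi.
case/andP => ib /IH [b' [s' [eb -> lb ls ps]]].
move: ib; rewrite eb => /(step _ _ lb) [i' [-> li] pi].
by exists i', (b' :: s'); rewrite /= pi lb.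
Qed.

Lemma embedded_regular d Pi Pi' i s j :
  embedded d Pi Pi' -> derivation Sigma Pi -> regular Pi -> j < size Pi ->
  ~ irregularity Pi' i s (d + j).
Proof.
move=> E D Reg lj [s0 ps [x [xi xj xs]]].
have [i' [s' [ei es li ls ps']]] := embedded_path E D lj ps.
apply: (Reg i' s' j); split=> //; first by move: s0; rewrite es; case: (s').
exists x; move: xi xj; rewrite ei !(embedded_clause_at E) //; split=> //.
apply/allP => h hs; move/allP: xs => /(_ (d + h)).
by rewrite es (embedded_clause_at E) ?(allP ls) //; apply; apply: map_f.
Qed.

(* The variables in U are those that may have been resolved away. *)
Definition regular_derives U C : Prop :=
  exists Pi, [/\ 0 < size Pi, derivation Sigma Pi, regular Pi,
    clause_at Pi (size Pi).-1 = C &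
    forall i, i < size Pi -> #|clause_at Pi i| <= k /\
      cvars (clause_at Pi i) \subset cvars C :|: U].

Lemma regular_derives_axiom U C :
  C \in Sigma -> #|C| <= k -> regular_derives U C.
Proof.
move=> CS Ck; exists [:: (C, None)]; split=> //.
- by case.
- move=> i s j [_ ps _]; move: ps.
  by rewrite rcons_path /premise_of; case: j => [|[|j]]; rewrite andbF.
- by case=> // _; split=> //; apply: subsetUl.
Qed.

(** The two derivations are concatenated and the resolvent is appended. Each copy inherits
    regularity, so only paths ending at the new line need a fresh argument. *)
Lemma regular_derives_resolvent U (x : V) P N :
  let R := P :\ (x, true) :|: N :\ (x, false) in
  regular_derives (U :\ x) P -> regular_derives (U :\ x) N ->
  (x, true) \in P -> (x, false) \in N -> x \in U ->
  #|R| <= k -> [disjoint cvars R & U] -> regular_derives U R.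
Proof.
move=> R [Pi1 [s1 D1 Reg1 L1 W1]] [Pi2 [s2 D2 Reg2 L2 W2]] xP xN xU Rk RU.
set n1 := size Pi1 in s1 L1 W1; set n2 := size Pi2 in s2 L2 W2.
pose last_line : line V := (R, Some (n1.-1, n1 + n2.-1)).
pose Pi := (Pi1 ++ map (shift_line n1) Pi2) ++ [:: last_line].
have szPi : size Pi = (n1 + n2).+1 by rewrite !size_cat size_map addn1.
have E1 : embedded 0 Pi1 Pi.
  move=> i li; rewrite /line_at !nth_cat size_cat -/n1 add0n li (ltn_addr _ li).
  by rewrite /shift_line; case: (nth _ _ _) => ? [[? ?]|].
have E2 : embedded n1 Pi2 Pi.
  move=> i li; rewrite /line_at !nth_cat size_cat size_map -/n1 ltn_add2l li.
  by rewrite ltnNge leq_addr /= addKn (nth_map (set0, None)).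
have El : line_at Pi (n1 + n2) = last_line.
  by rewrite /line_at nth_cat size_cat size_map ltnn subnn.
have idx i : i < size Pi -> [\/ i < n1,
    exists2 i', i = n1 + i' & i' < n2 | i = n1 + n2].
  rewrite szPi ltnS leq_eqVlt => /orP [/eqP ->|lt]; first by constructor 3.
  have [|le] := ltnP i n1; first by constructor 1.
  by constructor 2; exists (i - n1); rewrite ?subnKC // ltn_subLR.
have c1 i : i < n1 -> clause_at Pi i = clause_at Pi1 i.
  exact: (embedded_clause_at E1).
have c2 i : i < n2 -> clause_at Pi (n1 + i) = clause_at Pi2 i.
  exact: (embedded_clause_at E2).
have p1 : n1.-1 < n1 by rewrite prednK.
have p2 : n2.-1 < n2 by rewrite prednK.
have subP : cvars P \subset x |: cvars R.
  apply/subsetP => y /cvarsP [b yP]; rewrite inE in_set1.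
  case: eqP => //= yx; apply/cvarsP; exists b.
  by rewrite !inE yP xpair_eqE; case: eqP yx.
have subN : cvars N \subset x |: cvars R.
  apply/subsetP => y /cvarsP [b yN]; rewrite inE in_set1.
  case: eqP => //= yx; apply/cvarsP; exists b.
  by rewrite !inE yN !xpair_eqE; case: eqP yx; rewrite ?orbT.
have subU (Q : clause V) : cvars Q \subset x |: cvars R ->
    cvars Q :|: U :\ x \subset cvars R :|: U.
  move=> /subsetP sQ; apply/subsetP => y; rewrite !inE.
  case/orP => [/sQ|/andP [_ ->]]; last by rewrite orbT.
  by rewrite !inE => /orP [/eqP ->|->] //; rewrite xU orbT.
(* y in R is live, hence outside U, so it cannot have been resolved away
   before Q was derived. *)
have noirr (Q : clause V) y (c : {set V}) : c \subset cvars Q :|: U :\ x ->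
    y \in c -> y \in cvars R -> y \in cvars Q.
  move=> /subsetP sc /sc; rewrite !inE => /orP [] // /andP [_ yU] yR.
  by move/pred0P: RU => /(_ y) /=; rewrite yR yU.
exists Pi; split.
- by rewrite szPi.
- move=> i /idx [li|[i' -> li]|->].
  + move: (D1 i li); rewrite c1 // -[i in line_at Pi i]add0n E1 //=.
    case: (line_at Pi1 i).2 => //= -[p q] [pi qi res]; rewrite !add0n.
    by split=> //; rewrite !c1 //; apply: ltn_trans li.
  + move: (D2 i' li); rewrite c2 // E2 //=.
    case: (line_at Pi2 i').2 => //= -[p q] [pi qi res]; rewrite !ltn_add2l.
    by split=> //; rewrite !c2 //; apply: ltn_trans li.
  + rewrite {1}El /=; split.
    * by rewrite ltn_addr.
    * by rewrite ltn_add2l.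
    * rewrite c1 // c2 // L1 L2 /clause_at El.
      by exists (P :\ (x, true)), (N :\ (x, false)), x; rewrite !setD1K.
(* Beyond the end, the default line carries [None], so no path ends there. *)
- move=> i s j irr; have [|nj] := ltnP j (size Pi); last first.
    case: irr => _ + _; rewrite rcons_path => /andP [_].
    by rewrite /premise_of /line_at nth_default.
  case/idx => [lj|[j' ej lj]|ej].
  + exact: (@embedded_regular 0 _ _ i s j E1 D1 Reg1 lj irr).
  + by rewrite ej in irr; exact: (embedded_regular E2 D2 Reg2 lj irr).
  (* The line [b] just before the new one is a premise, and the path up to it stays in one copy. By
     [noirr], a variable shared by the start and [R] occurs in that premise, so [b] does not miss
     it. *)
  + case: irr; case/lastP: s => // s b _; rewrite rcons_path last_rcons ej.
    case/andP => pb; rewrite {1}/premise_of El /= => bE [y [yi yR]].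
    rewrite all_rcons => /andP [yb _]; case/negP: yb.
    have {}yR : y \in cvars R by move: yR; rewrite /clause_at El.
    case/orP: bE pb => /eqP -> pb.
    * have [i' [_ [ei _ li _ _]]] := @embedded_path 0 _ _ i s n1.-1 E1 D1 p1 pb.
      rewrite c1 // L1; apply: noirr (proj2 (W1 i' li)) _ yR.
      by rewrite -c1 // -[i']add0n -ei.
    * have [i' [_ [ei _ li _ _]]] := embedded_path E2 D2 p2 pb.
      rewrite c2 // L2; apply: noirr (proj2 (W2 i' li)) _ yR.
      by rewrite -c2 // -ei.
- by rewrite szPi /= /clause_at El.
- move=> i /idx [li|[i' -> li]|->].
  + by rewrite c1 //; have [-> /subset_trans -> //] := W1 i li; apply: subU.
  + by rewrite c2 //; have [-> /subset_trans -> //] := W2 i' li; apply: subU.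
  + by rewrite /clause_at El; split=> //; apply: subsetUl.
Qed.

Lemma regular_derives_refutation :
  regular_derives setT set0 ->
  exists Pi, [/\ refutation Sigma Pi, regular Pi & proof_width Pi <= k].
Proof.
move=> [Pi [s D Reg L W]]; exists Pi; split=> //.
apply/bigmax_leqP_seq => l lPi _.
have := W (index l Pi); rewrite index_mem /clause_at /line_at nth_index //.
by case/(_ lPi).
Qed.

End RegularDerivations.

(** * The cycle of implications *)

Section Equivalences.
Variables (V : finType) (Sigma : {set clause V}) (k : nat).
Hypothesis Sigma_width : cnf_width Sigma <= k.

Lemma axiom_width C : C \in Sigma -> #|C| <= k.
Proof. by move: C; apply/bigmax_leqP. Qed.

Lemma family_of_no_refutation :
  ~ (exists Pi : seq (line V),
       [/\ refutation Sigma Pi, regular Pi & proof_width Pi <= k]) ->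
  exists A : {set eassign V}, regular_extendible_family Sigma k.+1 A.
Proof.
move=> noref.
pose bad (alpha : eassign V) := exists C,
  falsifies alpha C /\ regular_derives Sigma k (unassigned alpha) C.
(* Excluded middle decides [bad] pointwise; as [eassign V] is finite, the decisions combine into one
   boolean function, which can define a set. *)
have [f fP] : exists f : eassign V -> bool, forall alpha, f alpha <-> bad alpha.
  apply: (@fin_all_exists _ _ (fun alpha (b : bool) => b <-> bad alpha)) => alpha.
  by case: (classic (bad alpha)) => H; [exists true | exists false].
exists [set alpha | (#|live_vars alpha| <= k.+1) && ~~ f alpha]; split.
- rewrite inE; apply/andP; split.
    by rewrite live_vars_empty cards0.
  (* Nothing is live in the empty assignment, so an offending clause is empty and its derivation is
     a refutation. *)
  apply/negP => /fP [C [/falsifiesP F der]].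
  apply: noref; apply: (@regular_derives_refutation V Sigma k).
  have -> : setT = unassigned (empty_eassign V).
    by apply/setP => x; rewrite !inE ffunE.
  suff <- : C = set0 by [].
  by apply/setP => -[x b]; rewrite inE; apply/negP => /F; rewrite ffunE.
- move=> alpha; rewrite inE => /andP [_ nf] C CS; apply: contra nf => F.
  by apply/fP; exists C; split=> //; apply/regular_derives_axiom/axiom_width.
- by move=> alpha; rewrite inE => /andP [].
- move=> alpha beta; rewrite !inE => /andP [la nf] fg; apply/andP; split.
    exact: leq_trans (subset_leq_card (forgets_live fg)) la.
  (* Forgetting never makes a variable unassigned again, so what offends [beta] also offends
     [alpha]. *)
  apply: contra nf => /fP [C [F der]]; apply/fP; exists C.
  by rewrite -(forgets_unassigned fg); split=> //; apply: forgets_falsifies F.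
- move=> alpha x; rewrite inE => /andP [_ nf]; rewrite ltnS => la ax.
  have [b nb] : exists b, ~~ f (assign alpha x b).
    have [fb|] := boolP (f (assign alpha x false)); last by exists false.
    have [ft|] := boolP (f (assign alpha x true)); last by exists true.
    have notbad C : regular_derives Sigma k (unassigned alpha :\ x) C ->
        regular_derives Sigma k (unassigned alpha) C.
      case=> Pi [s D Reg L W]; exists Pi; split=> // i /W [-> sub]; split=> //.
      by apply: subset_trans sub _; apply/setUS/subsetDl.
    case/negP: nf; apply/fP.
    move/fP: fb => [P [FP]]; rewrite unassigned_assign => dP.
    move/fP: ft => [N [FN]]; rewrite unassigned_assign => dN.
    have [aP|nP] := boolP (falsifies alpha P).
      by exists P; split; last exact: notbad dP.
    have xP := falsifies_assign FP nP.
    have [aN|nN] := boolP (falsifies alpha N).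
      by exists N; split; last exact: notbad dN.
    have xN := falsifies_assign FN nN.
    have FR : falsifies alpha (P :\ (x, true) :|: N :\ (x, false)).
      apply/falsifiesP => y c; rewrite !inE !xpair_eqE.
      move/falsifiesP: FP => FP; move/falsifiesP: FN => FN.
      case/orP => /andP [ne yc]; [move: (FP _ _ yc)|move: (FN _ _ yc)];
      by rewrite ffunE; move: ne; case: (y =P x) => //= _; case: c {yc}.
    exists (P :\ (x, true) :|: N :\ (x, false)); split=> //.
    (* A query happens with at most k live variables, which bounds the width of the falsified
       resolvent. *)
    apply: regular_derives_resolvent => //; first by rewrite inE ax.
      exact: leq_trans (card_falsified FR) la.
    exact: disjoint_live_unassigned.
  exists (assign alpha x b); split.
  + rewrite inE nb andbT live_vars_assign.
    by apply: leq_trans (leq_card_setU _ _) _; rewrite cards1 add1n.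
  + apply/forallP => y; rewrite ffunE.
    by case: (y =P x) => [->|_]; rewrite ?ax eqxx ?orbT.
  + by rewrite ffunE eqxx.
  + by move=> y /negPf yx; rewrite ffunE yx.
Qed.

(** The strategy answers [true] whenever this stays in [A], looking only at the latest assignment.
    The number of unassigned variables drops in each round; once it is zero, the premise of
    [next_round] is vacuous. *)
Lemma adversary_wins_of_family (j : nat) (A : {set eassign V}) :
  regular_extendible_family Sigma j A -> adversary_wins Sigma j.
Proof.
case=> A0 Anf Acard Aforget Aext.
pose s (h : seq (eassign V)) (x : V) : bool :=
  if h is alpha :: _ then assign alpha x true \in A else true.
exists s; move: [::] (empty_eassign V) A0 => h alpha.
have [n] := ubnP #|unassigned alpha|.
elim: n h alpha => // n IH h alpha ltn aA; apply: next_round.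
  by apply/exists_inP => -[C CS /andP [F _]]; move/negP: (Anf _ aA _ CS).
move=> x beta ax gamma lg fg.
have gA : gamma \in A.
  have la : #|live_vars alpha| < j.
    apply: leq_trans lg; rewrite live_vars_assign cardsU1.
    by rewrite !inE ax.
  have [delta [dA _ dx dy]] := Aext _ _ aA la ax.
  case dxE: (delta x) dx => [b| |] // _.
  (* The extension changes only [x], so it is one of the two possible answers. *)
  have ed : delta = assign alpha x b.
    by apply/ffunP => y; rewrite ffunE; case: eqP => [->|/eqP /dy].
  rewrite /gamma /=; have [//|nt] := boolP (assign alpha x true \in A).
  by move: dA nt; rewrite ed; case: b {dxE ed} => // ->.
apply: IH; last exact: Aforget gA fg.
rewrite (forgets_unassigned fg) unassigned_assign.
by move: ltn; rewrite (cardsD1 x) inE ax eqxx add1n ltnS.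
Qed.

(** * The Prover's walk up a regular refutation *)

Section ProverFollowsRefutation.
Variable Pi : seq (line V).
Hypotheses (PiD : derivation Sigma Pi) (PiR : regular Pi).
Hypothesis PiW : forall i, i < size Pi -> #|clause_at Pi i| <= k.

(** The invariant for queried variables on the walk: keeping the path to a nearest later occurrence
    provides the tail of an irregularity. *)
Definition occurs_from (i : nat) (x : V) : Prop :=
  x \in cvars (clause_at Pi i) \/
  exists mid j, [/\ path (premise_of Pi) i (rcons mid j),
    x \in cvars (clause_at Pi j) &
    all (fun h => x \notin cvars (clause_at Pi h)) mid].

(** The path is prolonged through [i], or stops at [i] if [x] occurs there. The last conjunct
    supplies the intermediate line that an irregularity requires. *)
Lemma occurs_from_premise p i x :
  premise_of Pi p i -> occurs_from i x ->
  exists mid j, [/\ path (premise_of Pi) p (rcons mid j),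
    x \in cvars (clause_at Pi j),
    all (fun h => x \notin cvars (clause_at Pi h)) mid &
    x \notin cvars (clause_at Pi i) -> mid != [::]].
Proof.
move=> pi; have [xi _|xi] := boolP (x \in cvars (clause_at Pi i)).
  by exists [::], i; rewrite /= pi.
case=> [xi'|[mid [j [ps xj xm]]]]; first by rewrite xi' in xi.
by exists (i :: mid), j; rewrite /= pi ps xi.
Qed.

Lemma falsified_premise (p q i : nat) :
  (line_at Pi i).2 = Some (p, q) -> i < size Pi ->
  exists x : V, forall b, exists r (E : clause V),
    [/\ r < i, premise_of Pi r i, clause_at Pi r = (x, ~~ b) |: E &
        E \subset clause_at Pi i].
Proof.
move=> ei li; move: (PiD li); rewrite ei => -[pi qi [C [D [x [eP eN eR]]]]].
exists x => -[]; [exists q, D | exists p, C]; split=> //.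
- by rewrite /premise_of ei eqxx orbT.
- by rewrite eR subsetUr.
- by rewrite /premise_of ei eqxx.
- by rewrite eR subsetUl.
Qed.

Lemma falsifies_premise (alpha : eassign V) (x : V) (b : bool) (E R : clause V) :
  alpha x = Live b -> E \subset R -> falsifies alpha R ->
  falsifies alpha ((x, ~~ b) |: E).
Proof.
move=> ax /subsetP sub /falsifiesP F; apply/falsifiesP => y c.
by rewrite !inE => /orP [/eqP [-> ->]|/sub /F //]; rewrite negbK.
Qed.

(** Induction on [i], since premises have smaller indices. The state of the variable resolved upon
    decides the move: live, go to the falsified premise without a query; unassigned, query it first;
    forgotten, contradict regularity. *)
Lemma prover_wins_along_refutation s i h (alpha : eassign V) :
  i < size Pi -> adversary_wins_from Sigma k.+1 s h alpha ->
  falsifies alpha (clause_at Pi i) -> #|live_vars alpha| <= k ->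
  ~ (forall x, alpha x <> Unassigned -> occurs_from i x).
Proof.
elim/ltn_ind: i h alpha => i IH h alpha li win F la occ.
have nwon : ~~ prover_won Sigma k.+1 alpha by case: win.
case ei: (line_at Pi i).2 => [[p q]|]; last first.
  move: (PiD li); rewrite ei => CS; case/negP: nwon; apply/exists_inP.
  exists (clause_at Pi i) => //; rewrite F /=.
  by apply/leqW/(leq_trans (leq_imset_card _ _))/axiom_width.
have [x prem] := falsified_premise ei li.
case ax: (alpha x) => [b| |].
- have [r [E [ri pr er sub]]] := prem b.
  apply: (IH r ri h alpha (ltn_trans ri li) win) => //.
    by rewrite er; apply: falsifies_premise F.
  move=> y /occ /(occurs_from_premise pr) [mid [j [? ? ? _]]].
  by right; exists mid, j.
- case: win ax la F occ => {nwon}[{}h {}alpha _ /(_ x) //|{}h {}alpha _ next].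
  move=> ax la F occ; set b := s (alpha :: h) x.
  have [r [E [ri pr er sub]]] := prem b.
  set gamma := assign alpha x b.
  pose Q := clause_at Pi r.
  have FQ : falsifies gamma Q.
    rewrite /Q er; apply: falsifies_premise sub _; first by rewrite ffunE eqxx.
    move/falsifiesP: (F) => F'; apply/falsifiesP => y c /F' ay.
    by rewrite ffunE ay; case: eqP ay => // ->; rewrite ax.
  (* Only the variables of [Q] stay live, at most k of them, which leaves room for another query. *)
  pose beta : eassign V := [ffun y =>
    if is_live (gamma y) && (y \notin cvars Q) then Forgotten else gamma y].
  have lr := ltn_trans ri li.
  apply: (IH r ri (alpha :: h) beta lr).
  + apply: next ax _ _.
      rewrite live_vars_assign; apply: leq_trans (leq_card_setU _ _) _.
      by rewrite cards1 add1n.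
    apply/forallP => y; rewrite ffunE.
    by case: ifP => [/andP [-> _]|]; rewrite eqxx ?orbT.
  + apply/falsifiesP => y c yQ; rewrite ffunE.
    have -> : y \in cvars Q by apply/cvarsP; exists c.
    by rewrite andbF; move/falsifiesP: FQ; apply.
  + apply: leq_trans (PiW lr); apply: leq_trans (leq_imset_card fst _).
    apply/subset_leq_card/subsetP => y; rewrite inE ffunE.
    by case: ifP => //; case: (gamma y) => //= b' /negbFE.
  + move=> y queried_y; have [->|yx] := eqVneq y x.
      by left; apply/cvarsP; exists (~~ b); rewrite er !inE eqxx.
    have /occ/(occurs_from_premise pr) [mid [j [? ? ? _]]] : alpha y <> Unassigned.
      by move=> ay; apply: queried_y; rewrite !ffunE (negPf yx) ay.
    by right; exists mid, j.
(* A forgotten [x] is absent from the falsified line [i] but occurs in both premises and, by the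
   invariant, further down: an irregularity through [i]. *)
- have xi : x \notin cvars (clause_at Pi i).
    apply/negP => /(subsetP (falsifies_live F)).
    by rewrite inE ax.
  have [r [E [ri pr er _]]] := prem true.
  have /(occurs_from_premise pr) [mid [j [ps xj xm /(_ xi) m0]]] :
    occurs_from i x by apply: occ; rewrite ax.
  apply: (PiR (i := r) (mid := mid) (j := j)); split=> //; exists x; split=> //.
  by apply/cvarsP; exists false; rewrite er !inE eqxx.
Qed.

End ProverFollowsRefutation.

Lemma no_refutation_of_adversary_wins :
  adversary_wins Sigma k.+1 ->
  ~ (exists Pi : seq (line V),
       [/\ refutation Sigma Pi, regular Pi & proof_width Pi <= k]).
Proof.
move=> [s win] [Pi [[s0 D e0] Reg W]].
have Wi i : i < size Pi -> #|clause_at Pi i| <= k.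
  by move=> li; move/bigmax_leqP_seq: W; apply; rewrite ?mem_nth.
have ll : (size Pi).-1 < size Pi by rewrite prednK.
(* The walk starts at the final empty clause, where nothing has been queried and the invariant is
   vacuous. *)
apply: (prover_wins_along_refutation D Reg Wi ll win).
- by rewrite e0; apply/falsifiesP => x b; rewrite inE.
- by rewrite live_vars_empty cards0.
- by move=> x; rewrite ffunE.
Qed.

End Equivalences.

Theorem theorem3p2 (V : finType) (Sigma : {set clause V}) (k : nat)
    (hk : cnf_width Sigma <= k) :
  [<-> ~ (exists Pi : seq (line V),
            [/\ refutation Sigma Pi, regular Pi & proof_width Pi <= k]);
       exists A : {set eassign V}, regular_extendible_family Sigma k.+1 A;
       adversary_wins Sigma k.+1].
Proof.
tfae.
- exact: family_of_no_refutation.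
- by case=> A; apply: adversary_wins_of_family.
- exact: no_refutation_of_adversary_wins.
Qed.
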